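(* Let $\psi(\lambda_{\mathcal A},\lambda_{\mathcal B})=\int_\Sigma f_{\mathcal A,\sigma}(\lambda_{\mathcal A})f_{\mathcal B,\sigma}(\lambda_{\mathcal B})\,d\mu(\sigma)\in\Psi_U$ be such that $\|f^{(k)}_{\mathcal A,\sigma}\|_\infty$ and $\|f^{(k)}_{\mathcal B,\sigma}\|_\infty$ are bounded for $k=0,1,2$, where the superscript $(k)$ denotes the $k$-th derivative, and where the measure space satisfies $\Sigma=\bigcup_{i=1}^\infty S_i$ as in the definition of $\Psi_U$. Let $\{\mathcal E_{\mathcal A,t}\}$, $\{\mathcal E_{\mathcal B,t}\}$, $t\in\mathbb{R}$, be two indexed families of independent random Hermitian tensors in $\mathbb{C}^{I_1\times\cdots\times I_N\times I_1\times\cdots\times I_N}$ of the form $$\mathcal E_{\mathcal A,t}=\sum_{i=1}^{\mathbb{I}_1^N}\lambda_{\mathcal A,i}\mathcal P_{\mathcal A,t,i},\qquad\mathcal E_{\mathcal B,t}=\sum_{i=1}^{\mathbb{I}_1^N}\lambda_{\mathcal B,i}\mathcal P_{\mathcal B,t,i},$$ such that $$\lim_{t\to0}\mathbb{E}\left(\|\mathcal E_{\mathcal A,t}-\mathcal E_{\mathcal A,0}\|\right)=0,\qquad\lim_{t\to0}\mathbb{E}\left(\|\mathcal E_{\mathcal B,t}-\mathcal E_{\mathcal B,0}\|\right)=0 .$$ If $T_{\psi,t}$ is the random PDTI associated with $\psi$ and the random tensors $\mathcal P_{\mathcal A,t,i},\mathcal P_{\mathcal B,t,i}$, then $$\lim_{t\to0}\mathbb{E}\left(\|T_{\psi,t}-T_{\psi,0}\|\right)=0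 .$$
   Context: Tensors. $\mathbb{I}_1^N=I_1\cdots I_N$. For square tensors the Einstein product is $(\mathcal X\star_N\mathcal Y)_{i_1\ldots i_N,k_1\ldots k_N}=\sum_{j_1,\ldots,j_N}x_{i_1\ldots i_N,j_1\ldots j_N}y_{j_1\ldots j_N,k_1\ldots k_N}$. The displayed decompositions of $\mathcal E_{\mathcal A,t},\mathcal E_{\mathcal B,t}$ are eigen-decompositions: the $\lambda$'s are real (random) eigenvalues and each $\mathcal P=\mathcal U\star_1\mathcal U^H$ is the (random) projection onto an eigentensor $\mathcal U\in\mathbb{C}^{I_1\times\cdots\times I_N\times1}$, the eigentensors being orthonormal. $\|\cdot\|$ on tensors is the spectral norm (largest singular value); on linear maps of tensors it is the induced operator norm. Class $\Psi$. $\Psi$ is the set of functions $\psi:\mathbb{R}\times\mathbb{R}\to\mathbb{C}$ with a representation $\psi(\lambda_{\mathcal A},\lambda_{\mathcal B})=\int_\Sigma f_{\mathcal A,\sigma}(\lambda_{\mathcal A})f_{\mathcal B,\sigma}(\lambda_{\mathcal B})\,d\mu(\sigma)$, where $(\Sigma,\mu)$ is a measure space and $f_{\mathcal A,\sigma},f_{\mathcal B,\sigma}:\mathbb{R}\to\mathbb{C}$ are bounded with $\int_\Sigma\|f_{\mathcal A,\sigma}\|_\infty\|f_{\mathcal B,\sigma}\|_\infty d\mu(\sigma)<\infty$ (the sum of two such representations being again of this form). $\Psi_U\subset\Psi$ consists of those $\psi$ having a representation for which there is an increasing sequence of measurable subsets $S_i\subset\Sigma$, $i=1,2,\ldots$,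 with $\Sigma=\bigcup_{i=1}^\infty S_i$, such that for every $i$ the family of functions $\{f_{\mathcal A,\sigma},f_{\mathcal B,\sigma}\}_{\sigma\in S_i}$ is uniformly continuous (with a modulus of continuity common to the family). PDTI. $$T_{\psi,t}(\mathcal X)=\int_\Sigma\Big(\sum_{i=1}^{\mathbb{I}_1^N}f_{\mathcal A,\sigma}(\lambda_{\mathcal A,i})\mathcal P_{\mathcal A,t,i}\Big)\star_N\mathcal X\star_N\Big(\sum_{j=1}^{\mathbb{I}_1^N}f_{\mathcal B,\sigma}(\lambda_{\mathcal B,j})\mathcal P_{\mathcal B,t,j}\Big)d\mu(\sigma),\qquad\mathcal X\in\mathbb{C}^{I_1\times\cdots\times I_N\times I_1\times\cdots\times I_N}.$$ *)

(* Defs.v *)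
From HB Require Import structures.
From mathcomp Require Import all_boot all_order all_algebra.
From mathcomp Require Import complex.
From mathcomp Require Import all_classical all_reals all_analysis.

Set Implicit Arguments.
Unset Strict Implicit.
Unset Printing Implicit Defensive.

Import Order.TTheory GRing.Theory Num.Theory.
Import numFieldNormedType.Exports.

Local Open Scope classical_set_scope.
Local Open Scope complex_scope.
Local Open Scope ring_scope.

(* A shape I_1 x ... x I_N is a function I : 'I_N -> nat; a tensor of type
   [tensor R I J] is an array in C^(I_1 x ... x I_N x J_1 x ... x J_M), its
   entries being indexed by pairs of multi-indices. *)
Notation midx I := {dffun forall k, 'I_(I k)}.
Notation tensor R I J := {ffun midx I * midx J -> R[i]^o}.

(* The shape of the last mode of an eigentensor in C^(I_1 x ... x I_N x 1). *)
Definition shape1 : 'I_1 -> nat := fun=> 1%N.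

Notation eigentensor R I := (tensor R I shape1).

Section Tensors.
Context {R : realType}.

(* X *_M Y, contracting the M modes of shape J. *)
Definition einstein {N M L : nat} {I : 'I_N -> nat} {J : 'I_M -> nat}
    {K : 'I_L -> nat} (X : tensor R I J) (Y : tensor R J K) : tensor R I K :=
  [ffun p => \sum_(j : midx J) X (p.1, j) * Y (j, p.2)].

Definition adjoint {N M : nat} {I : 'I_N -> nat} {J : 'I_M -> nat}
    (X : tensor R I J) : tensor R J I :=
  [ffun p => (X (p.2, p.1))^*].

Definition idtensor {N : nat} (I : 'I_N -> nat) : tensor R I I :=
  [ffun p => (p.1 == p.2)%:R].

Definition hermitian_tensor {N : nat} {I : 'I_N -> nat} (X : tensor R I I) : Prop :=
  adjoint X = X.

Definition orthonormal_family {N n : nat} {I : 'I_N -> nat}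
    (U : 'I_n -> eigentensor R I) : Prop :=
  forall i j, einstein (adjoint (U i)) (U j) = (i == j)%:R *: idtensor shape1.

(* [P] lists the rank-one projections U_i *_1 U_i^H on an orthonormal family
   of eigentensors, and E = sum_i lam_i P_i. *)
Definition eigen_decomposition {N n : nat} {I : 'I_N -> nat}
    (lam : 'I_n -> R) (P : 'I_n -> tensor R I I) (E : tensor R I I) : Prop :=
  (exists U : 'I_n -> eigentensor R I,
     orthonormal_family U /\ forall i, P i = einstein (U i) (adjoint (U i))) /\
  E = \sum_i (lam i)%:C *: P i.

(* s is a singular value of X when s >= 0 and s^2 is an eigenvalue of
   X^H *_N X. *)
Definition singular_value {N : nat} {I : 'I_N -> nat} (X : tensor R I I)
    (s : R) : Prop :=
  0 <= s /\ exists V : eigentensor R I,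
    V != 0 /\ einstein (einstein (adjoint X) X) V = (s ^+ 2)%:C *: V.

(* The supremum is over a finite set, non-empty when the dimensions are
   positive. *)
Definition spectral_norm {N : nat} {I : 'I_N -> nat} (X : tensor R I I) : R :=
  sup [set s | singular_value X s].

(* The induced norm; the supremum is finite for linear T. *)
Definition operator_norm {N : nat} {I : 'I_N -> nat}
    (T : tensor R I I -> tensor R I I) : R :=
  sup [set spectral_norm (T X) | X in [set X | spectral_norm X <= 1]].

(* The Borel sets of C^(I x I): the sigma-algebra generated by the real and
   imaginary parts of the entries. *)
Definition tensor_borel {N : nat} (I : 'I_N -> nat) :
    set (set (tensor R I I)) :=
  <<s [set A | exists (p : midx I * midx I) (B : set R), measurable B /\
         (A = [set X : tensor R I I | B (complex.Re (X p))] \/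
          A = [set X : tensor R I I | B (complex.Im (X p))])] >>.

Definition random_tensor {d} {Omega : measurableType d} {N : nat}
    {I : 'I_N -> nat} (X : Omega -> tensor R I I) : Prop :=
  forall B, tensor_borel B -> measurable (X @^-1` B).

Definition independent_tensors {d} {Omega : measurableType d}
    (Pr : probability Omega R) {N : nat} {I : 'I_N -> nat}
    (X Y : Omega -> tensor R I I) : Prop :=
  forall B C, tensor_borel B -> tensor_borel C ->
    Pr (X @^-1` B `&` Y @^-1` C) = (Pr (X @^-1` B) * Pr (Y @^-1` C))%E.

Definition cmod (z : R[i]) : R := complex.Re `|z|.

Definition supnorm (f : R -> R[i]) : \bar R :=
  ereal_sup [set (cmod (f x))%:E | x in setT].

(* Complex-valued functions of a real variable are differentiated
   componentwise. *)
Definition cderive (k : nat) (f : R -> R[i]) : R -> R[i] :=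
  fun x => derive1n k (fun y => complex.Re (f y)) x +i*
           derive1n k (fun y => complex.Im (f y)) x.

Definition cderivable (f : R -> R[i]) : Prop :=
  forall x, derivable (fun y => complex.Re (f y)) x 1 /\
            derivable (fun y => complex.Im (f y)) x 1.

Definition bounded_derivatives2 (f : R -> R[i]) : Prop :=
  (forall k, (k < 2)%N -> cderivable (cderive k f)) /\
  (forall k, (k <= 2)%N -> (supnorm (cderive k f) < +oo)%E).

Section Classes.
Context {d : measure_display} {Sigma : measurableType d}.
Variable mu : {measure set Sigma -> \bar R}.

Definition cmeasurable (g : Sigma -> R[i]) : Prop :=
  measurable_fun setT (fun s => complex.Re (g s)) /\
  measurable_fun setT (fun s => complex.Im (g s)).

Definition cintegral (g : Sigma -> R[i]) : R[i] :=
  (\int[mu]_s complex.Re (g s)) +i* (\int[mu]_s complex.Im (g s)).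

(* The measurability of the integrand of psi and of the product of the norms
   (the latter contained in [integrable]) is what gives a meaning to the
   integrals; mu is not assumed sigma-finite. *)
Definition Psi_representation (fA fB : Sigma -> R -> R[i])
    (psi : R -> R -> R[i]) : Prop :=
  [/\ forall s, (supnorm (fA s) < +oo)%E /\ (supnorm (fB s) < +oo)%E,
      forall x y, cmeasurable (fun s => fA s x * fB s y),
      mu.-integrable setT (fun s => (supnorm (fA s) * supnorm (fB s))%E) &
      forall x y, psi x y = cintegral (fun s => fA s x * fB s y)].

Definition uniformly_equicontinuous (S : set Sigma) (f g : Sigma -> R -> R[i]) :
    Prop :=
  forall e : R, 0 < e -> exists2 delta : R, 0 < delta &
    forall s x y, S s -> `|x - y| < delta ->
      cmod (f s x - f s y) < e /\ cmod (g s x - g s y) < e.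

Definition PsiU_representation (fA fB : Sigma -> R -> R[i])
    (psi : R -> R -> R[i]) : Prop :=
  Psi_representation fA fB psi /\
  exists S : nat -> set Sigma,
    [/\ forall i, measurable (S i),
        forall i, S i `<=` S i.+1,
        \bigcup_i S i = setT &
        forall i, uniformly_equicontinuous (S i) fA fB].

Definition tensor_integral {N : nat} {I : 'I_N -> nat}
    (F : Sigma -> tensor R I I) : tensor R I I :=
  [ffun p => cintegral (fun s => F s p)].

Definition double_tensor_integral {N n : nat} {I : 'I_N -> nat}
    (fA fB : Sigma -> R -> R[i]) (lamA lamB : 'I_n -> R)
    (PA PB : 'I_n -> tensor R I I) (X : tensor R I I) : tensor R I I :=
  tensor_integral (fun s =>
    einstein (einstein (\sum_i fA s (lamA i) *: PA i) X)
             (\sum_j fB s (lamB j) *: PB j)).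

End Classes.
End Tensors.

(* Main.v *)
Require Import Defs.
From HB Require Import structures.
From mathcomp Require Import all_boot all_order all_algebra.
From mathcomp Require Import complex.
From mathcomp Require Import all_classical all_reals all_analysis.
From mathcomp Require Import measurable_realfun ring lra.

Set Implicit Arguments.
Unset Strict Implicit.
Unset Printing Implicit Defensive.

Import Order.TTheory GRing.Theory Num.Theory.
Import numFieldNormedType.Exports.

Local Open Scope classical_set_scope.
Local Open Scope complex_scope.
Local Open Scope ring_scope.

(** Everything reduces to two facts about the symbol psi and one computation
with finite matrices.

Since both decompositions have rank-one projections on orthonormal families,
integrating under the finite sums gives the transform in the form
T_psi(X) = sum_(i, j) psi(lam_i, mu_j) P_i X Q_j. Only the values of psi matter
from there on. A function of the class Psi is bounded
([Psi_bounded]), and one of the class Psi_U is uniformly continuous on the plane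
([PsiU_unif_continuous]). The latter cannot be read off from a common modulus of
continuity on the sets S_i, because the product rule leaves the norm of a single
factor, which need not be integrable over S_i. Instead, for each fixed sigma the
integrand f_(A,sigma)(x) f_(B,sigma)(y) is uniformly continuous in (x, y), and
it is dominated by the integrable product of the sup norms; dominated convergence
along sequences then makes the integral uniformly continuous
([dominated_Rintegral_unif_continuous]).

To compare the transforms built from (P, Q) and (P', Q'), resolve the identity
with the other family on both sides of X:

  T(X) - T'(X) = sum_(i, j, k, l) (psi(lam_i, mu_j) - psi(lam'_k, mu'_l))
                                  P_i P'_k X Q'_l Q_j.

When lam_i is close to lam'_k and mu_j to mu'_l the coefficient is small. When,
say, |lam_i - lam'_k| >= delta, the coefficient is bounded and the overlap is
small, because (lam_i - lam'_k) P_i P'_k = P_i (E - E') P'_k. Hence, for every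
eps > 0, there is a constant c such that pointwise in the random outcome and for
every t ([double_tensor_integral_perturb])

  ||T_t - T_0|| <= eps + c (||E_A,t - E_A,0|| + ||E_B,t - E_B,0||),

and taking expectations ends the proof. All estimates are made with the sum of
the moduli of the entries, which is submultiplicative, is a measurable function
of a random tensor, and is equivalent to the spectral norm
([spectral_norm_le_l1norm], [l1norm_le_spectral_norm]). The measurability of the
spectral and operator norms is avoided: for nonnegative functions the integral
is a supremum over the simple functions below, hence monotone without any
measurability ([le_ge0_integral]). *)

(** * The modulus of a complex number as a real number *)

Section ComplexModulus.
Context {R : realType}.
Implicit Types z : R[i].

Lemma cmodE z : (cmod z)%:C = `|z|.
Proof. by rewrite /cmod RRe_real // normr_real. Qed.

Lemma cmod_ge0 z : 0 <= cmod z.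
Proof. by rewrite -lecR cmodE normr_ge0. Qed.

Lemma cmod0 : cmod (0 : R[i]) = 0.
Proof. by apply: complexI; rewrite cmodE normr0. Qed.

Lemma cmod_eq0 z : (cmod z == 0) = (z == 0).
Proof. by rewrite -(inj_eq (@complexI _)) cmodE normr_eq0. Qed.

Lemma cmodN z : cmod (- z) = cmod z.
Proof. by apply: complexI; rewrite !cmodE normrN. Qed.

Lemma cmodM z z' : cmod (z * z') = cmod z * cmod z'.
Proof. by apply: complexI; rewrite rmorphM /= !cmodE normrM. Qed.

Lemma cmodJ z : cmod (Num.conj z) = cmod z.
Proof. by apply: complexI; rewrite !cmodE norm_conjC. Qed.

Lemma cmodR (x : R) : cmod x%:C = `|x|.
Proof. by rewrite /cmod normc_def /= expr0n addr0 sqrtr_sqr. Qed.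

Lemma cmodD z z' : cmod (z + z') <= cmod z + cmod z'.
Proof. by rewrite -lecR rmorphD /= !cmodE ler_normD. Qed.

Lemma cmodB z z' : cmod (z - z') <= cmod z + cmod z'.
Proof. by rewrite -(cmodN z') cmodD. Qed.

Lemma cmod_sum (J : Type) (r : seq J) (P : pred J) (F : J -> R[i]) :
  cmod (\sum_(j <- r | P j) F j) <= \sum_(j <- r | P j) cmod (F j).
Proof.
elim/big_ind2: _ => [|x1 x2 y1 y2 h1 h2|//]; first by rewrite cmod0.
by rewrite (le_trans (cmodD _ _)) // lerD.
Qed.

Lemma sqr_cmod z : cmod z ^+ 2 = complex.Re z ^+ 2 + complex.Im z ^+ 2.
Proof. by apply: complexI; rewrite rmorphXn /= cmodE -add_Re2_Im2. Qed.

Lemma normRe_le_cmod z : `|complex.Re z| <= cmod z.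
Proof.
rewrite -(@ler_pXn2r _ 2) ?nnegrE ?cmod_ge0 // sqr_cmod real_normK ?num_real //.
by rewrite lerDl sqr_ge0.
Qed.

Lemma normIm_le_cmod z : `|complex.Im z| <= cmod z.
Proof.
rewrite -(@ler_pXn2r _ 2) ?nnegrE ?cmod_ge0 // sqr_cmod real_normK ?num_real //.
by rewrite lerDr sqr_ge0.
Qed.

Lemma cmod_le_ReIm z : cmod z <= `|complex.Re z| + `|complex.Im z|.
Proof.
rewrite -(@ler_pXn2r _ 2) ?nnegrE ?cmod_ge0 ?addr_ge0 // sqr_cmod sqrrD.
rewrite !real_normK ?num_real // -addrA lerD2l -[leLHS]add0r lerD2r.
by rewrite mulrn_wge0 // mulr_ge0.
Qed.

Lemma ReD (z w : R[i]) : complex.Re (z + w) = complex.Re z + complex.Re w.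
Proof. by case: z w => [? ?] []. Qed.

Lemma ImD (z w : R[i]) : complex.Im (z + w) = complex.Im z + complex.Im w.
Proof. by case: z w => [? ?] []. Qed.

Lemma ReM (z w : R[i]) : complex.Re (z * w) =
  complex.Re z * complex.Re w - complex.Im z * complex.Im w.
Proof. by case: z w => [? ?] []. Qed.

Lemma ImM (z w : R[i]) : complex.Im (z * w) =
  complex.Re z * complex.Im w + complex.Im z * complex.Re w.
Proof. by case: z w => [? ?] []. Qed.

End ComplexModulus.

(** * The entrywise l1 norm of complex matrices *)

Section EntrywiseNorm.
Context {R : realType}.
Local Notation C := R[i].

Definition l1norm m n (A : 'M[C]_(m, n)) : R := \sum_i \sum_j cmod (A i j).

Lemma l1norm_ge0 m n (A : 'M[C]_(m, n)) : 0 <= l1norm A.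
Proof. by apply: sumr_ge0 => i _; apply: sumr_ge0 => j _; exact: cmod_ge0. Qed.

Lemma l1norm0 m n : l1norm (0 : 'M[C]_(m, n)) = 0.
Proof.
by apply: big1 => i _; apply: big1 => j _; rewrite mxE cmod0.
Qed.

Lemma cmod_le_l1norm m n (A : 'M[C]_(m, n)) i j : cmod (A i j) <= l1norm A.
Proof.
rewrite /l1norm (bigD1 i) //= (bigD1 j) //= -addrA lerDl addr_ge0 //.
  by apply: sumr_ge0 => *; exact: cmod_ge0.
by apply: sumr_ge0 => ? _; apply: sumr_ge0 => *; exact: cmod_ge0.
Qed.

Lemma l1norm_gt0 m n (A : 'M[C]_(m, n)) : A != 0 -> 0 < l1norm A.
Proof.
move=> A0; rewrite lt_neqAle l1norm_ge0 andbT; apply: contra A0 => /eqP A0.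
apply/eqP/matrixP => i j; rewrite mxE; apply/eqP; rewrite -cmod_eq0.
by rewrite eq_le cmod_ge0 andbT A0 cmod_le_l1norm.
Qed.

Lemma l1normZ m n a (A : 'M[C]_(m, n)) : l1norm (a *: A) = cmod a * l1norm A.
Proof.
rewrite /l1norm mulr_sumr; apply: eq_bigr => i _; rewrite mulr_sumr.
by apply: eq_bigr => j _; rewrite mxE cmodM.
Qed.

Lemma l1normN m n (A : 'M[C]_(m, n)) : l1norm (- A) = l1norm A.
Proof.
by apply: eq_bigr => i _; apply: eq_bigr => j _; rewrite mxE cmodN.
Qed.

Lemma l1normD m n (A B : 'M[C]_(m, n)) : l1norm (A + B) <= l1norm A + l1norm B.
Proof.
rewrite /l1norm -big_split; apply: ler_sum => i _ /=; rewrite -big_split.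
by apply: ler_sum => j _; rewrite mxE cmodD.
Qed.

Lemma l1norm_sum (J : Type) (r : seq J) (P : pred J) m n
    (F : J -> 'M[C]_(m, n)) :
  l1norm (\sum_(j <- r | P j) F j) <= \sum_(j <- r | P j) l1norm (F j).
Proof.
elim/big_ind2: _ => [|x1 x2 y1 y2 h1 h2|//]; first by rewrite l1norm0.
by rewrite (le_trans (l1normD _ _)) // lerD.
Qed.

Lemma l1normM m n p (A : 'M[C]_(m, n)) (B : 'M[C]_(n, p)) :
  l1norm (A *m B) <= l1norm A * l1norm B.
Proof.
rewrite /l1norm mulr_suml; apply: ler_sum => i _.
apply: (@le_trans _ _ (\sum_k \sum_j cmod (A i j) * cmod (B j k))).
  apply: ler_sum => k _; rewrite mxE (le_trans (cmod_sum _ _ _)) //.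
  by apply: ler_sum => j _; rewrite cmodM.
rewrite exchange_big mulr_suml; apply: ler_sum => j _ /=.
rewrite -mulr_sumr ler_wpM2l ?cmod_ge0 //.
rewrite [leRHS](bigD1 j) //= lerDl.
by apply: sumr_ge0 => ? _; apply: sumr_ge0 => *; exact: cmod_ge0.
Qed.

Lemma l1norm_adjoint m n (A : 'M[C]_(m, n)) :
  l1norm (map_mx Num.conj A^T) = l1norm A.
Proof.
rewrite /l1norm exchange_big; apply: eq_bigr => i _; apply: eq_bigr => j _.
by rewrite !mxE cmodJ.
Qed.

End EntrywiseNorm.

(** * Perturbation of double sums over resolutions of the identity *)

Section MatrixTransform.
Context {R : realType} {n : nat}.
Local Notation C := R[i].
Implicit Types (P Q : 'I_n -> 'M[C]_n) (X : 'M[C]_n) (lam mu : 'I_n -> R).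

(** A resolution of the identity by mutually orthogonal idempotents. The third
clause records the only further property of a rank-one orthogonal projection
u u^H that the estimates use: the entries of the unit vector u have modulus at
most 1. *)
Definition resolution P : Prop :=
  [/\ forall i j, P i *m P j = (i == j)%:R *: P i,
      \sum_i P i = 1%:M &
      forall i, l1norm (P i) <= n%:R ^+ 2].

Definition spectral_sum lam P : 'M[C]_n := \sum_i (lam i)%:C *: P i.

(** The value at X of phi(L, M), where L : X -> E X and M : X -> X F are the
commuting multiplications by the spectral sums E of (lam, P) and F of
(mu, Q). *)
Definition bimodule_sum (phi : R -> R -> C) lam mu P Q X : 'M[C]_n :=
  \sum_i \sum_j phi (lam i) (mu j) *: (P i *m X *m Q j).

Lemma mul_spectral_sum lam P i :
  resolution P -> P i *m spectral_sum lam P = (lam i)%:C *: P i.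
Proof.
case=> PP _ _; rewrite mulmx_sumr (bigD1 i) //= big1 => [|j ji].
  by rewrite -scalemxAr PP eqxx scale1r addr0.
by rewrite -scalemxAr PP eq_sym (negbTE ji) scale0r scaler0.
Qed.

Lemma spectral_sum_mul lam P i :
  resolution P -> spectral_sum lam P *m P i = (lam i)%:C *: P i.
Proof.
case=> PP _ _; rewrite mulmx_suml (bigD1 i) //= big1 => [|j ji].
  by rewrite -scalemxAl PP eqxx scale1r addr0.
by rewrite -scalemxAl PP (negbTE ji) scale0r scaler0.
Qed.

(** Spectral projections of nearby matrices belonging to distant eigenvalues
almost annihilate each other: P_i E = lam_i P_i and E' P'_k = lam'_k P'_k turn
the gap lam_i - lam'_k into the difference E - E' of the matrices. *)
Lemma overlap_le lam lam' P P' (delta : R) i k :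
  resolution P -> resolution P' -> 0 < delta ->
  delta <= `|lam i - lam' k| ->
  l1norm (P i *m P' k) <=
    n%:R ^+ 4 * (l1norm (spectral_sum lam P - spectral_sum lam' P') / delta).
Proof.
move=> rP rP' d0 dlam; set D := _ - _.
have PDP : P i *m D *m P' k = (lam i - lam' k)%:C *: (P i *m P' k).
  rewrite mulmxBr mulmxBl mul_spectral_sum // -mulmxA spectral_sum_mul //.
  by rewrite -scalemxAl -scalemxAr -scalerBl rmorphB.
have [_ _ /(_ i) Pi] := rP; have [_ _ /(_ k) Pk] := rP'.
rewrite mulrA ler_pdivlMr // mulrC.
apply: (@le_trans _ _ (l1norm (P i *m D *m P' k))).
  by rewrite PDP l1normZ cmodR ler_wpM2r ?l1norm_ge0.
rewrite (le_trans (l1normM _ _)) // (exprD _ 2 2) mulrAC.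
rewrite ler_pM ?l1norm_ge0 // (le_trans (l1normM _ _)) //.
by rewrite ler_wpM2r ?l1norm_ge0.
Qed.

Lemma overlap_le_dim P P' i k :
  resolution P -> resolution P' -> l1norm (P i *m P' k) <= n%:R ^+ 4.
Proof.
move=> [_ _ /(_ i) Pi] [_ _ /(_ k) Pk]; rewrite (le_trans (l1normM _ _)) //.
by rewrite (exprD _ 2 2) ler_pM ?l1norm_ge0.
Qed.

(** Two expansions over the same quadruple index set, one for each of the
transforms to be compared; the terms of both contain the same product
P_i P'_k X Q'_l Q_j once the roles of the families are exchanged. *)
Lemma bimodule_sum_insert_inner (phi : R -> R -> C) lam mu P Q P' Q' X :
  \sum_k P' k = 1%:M -> \sum_l Q' l = 1%:M ->
  bimodule_sum phi lam mu P Q X =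
  \sum_i \sum_j \sum_k \sum_l
    phi (lam i) (mu j) *: ((P i *m P' k) *m X *m (Q' l *m Q j)).
Proof.
move=> sP' sQ'; apply: eq_bigr => i _; apply: eq_bigr => j _.
rewrite -[in LHS](mulmx1 (P i)) -sP' -[in LHS](mul1mx (Q j)) -sQ'.
rewrite mulmx_sumr mulmx_suml mulmx_suml scaler_sumr; apply: eq_bigr => k _.
by rewrite mulmx_suml mulmx_sumr scaler_sumr.
Qed.

Lemma bimodule_sum_insert_outer (phi : R -> R -> C) lam mu P Q P' Q' X :
  \sum_i P' i = 1%:M -> \sum_j Q' j = 1%:M ->
  bimodule_sum phi lam mu P Q X =
  \sum_i \sum_j \sum_k \sum_l
    phi (lam k) (mu l) *: ((P' i *m P k) *m X *m (Q l *m Q' j)).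
Proof.
move=> sP' sQ'; rewrite /bimodule_sum; symmetry.
under eq_bigr => i _.
  rewrite exchange_big; under eq_bigr do rewrite exchange_big; over.
rewrite exchange_big; apply: eq_bigr => k _ /=.
rewrite exchange_big; apply: eq_bigr => l _ /=.
rewrite -[in RHS](mul1mx (P k)) -sP' -[in RHS](mulmx1 (Q l)) -sQ'.
rewrite !mulmx_suml scaler_sumr; apply: eq_bigr => i _.
by rewrite mulmx_sumr mulmx_sumr scaler_sumr.
Qed.

(** The quadruple sum has n^4 terms. In each of them either both pairs of
eigenvalues are close, and the difference of the values of phi is small, or one
pair is at distance at least delta and [overlap_le] applies. Each overlap
contributes a factor n^4, whence n^12 in total. *)
Lemma bimodule_sum_perturb (phi : R -> R -> C) lam lam' mu mu' P P' Q Q'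
    (M e delta : R) X :
  resolution P -> resolution P' -> resolution Q -> resolution Q' ->
  0 <= e -> 0 < delta ->
  (forall x y, cmod (phi x y) <= M) ->
  (forall x y x' y', `|x - x'| < delta -> `|y - y'| < delta ->
     cmod (phi x y - phi x' y') <= e) ->
  l1norm (bimodule_sum phi lam mu P Q X - bimodule_sum phi lam' mu' P' Q' X) <=
  n%:R ^+ 12 *
    (e + 2 * M / delta * (l1norm (spectral_sum lam P - spectral_sum lam' P') +
                          l1norm (spectral_sum mu Q - spectral_sum mu' Q')))
  * l1norm X.
Proof.
move=> rP rP' rQ rQ' e0 d0 phiM phie.
have [_ sP _] := rP; have [_ sP' _] := rP'.
have [_ sQ _] := rQ; have [_ sQ' _] := rQ'.
rewrite (bimodule_sum_insert_inner _ _ _ _ _ _ sP' sQ').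
rewrite (bimodule_sum_insert_outer _ _ _ _ _ _ sP sQ).
set a := l1norm (spectral_sum lam P - _).
set b := l1norm (spectral_sum mu Q - _).
have a0 : 0 <= a by exact: l1norm_ge0.
have b0 : 0 <= b by exact: l1norm_ge0.
have M0 : 0 <= M by exact: le_trans (cmod_ge0 _) (phiM 0 0).
set B := e + _; pose K : R := n%:R ^+ 4.
have K0 : 0 <= K by rewrite exprn_ge0.
have ab0 : 0 <= 2 * M / delta * a /\ 0 <= 2 * M / delta * b.
  by split; rewrite !mulr_ge0 // invr_ge0 ltW.
have term i j k l :
    cmod (phi (lam i) (mu j) - phi (lam' k) (mu' l)) *
    (l1norm (P i *m P' k) * l1norm (Q' l *m Q j)) <= K ^+ 2 * B.
  have oP := overlap_le_dim i k rP rP'; have oQ := overlap_le_dim l j rQ' rQ.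
  have p2M : cmod (phi (lam i) (mu j) - phi (lam' k) (mu' l)) <= 2 * M.
    by rewrite (le_trans (cmodB _ _)) // mulr_natl mulr2n lerD.
  have [dlam|dlam] := ltP `|lam i - lam' k| delta; last first.
    have {}oP := overlap_le rP rP' d0 dlam.
    apply: (@le_trans _ _ (2 * M * (K * (a / delta) * K))).
      by rewrite !ler_pM ?cmod_ge0 ?mulr_ge0 ?l1norm_ge0.
    rewrite (_ : _ * _ = K ^+ 2 * (2 * M / delta * a)); last by ring.
    by rewrite ler_wpM2l ?exprn_ge0 // /B mulrDr; lra.
  have [dmu|dmu] := ltP `|mu j - mu' l| delta; last first.
    rewrite distrC in dmu; have {}oQ := overlap_le rQ' rQ d0 dmu.
    have bE : b = l1norm (spectral_sum mu' Q' - spectral_sum mu Q).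
      by rewrite -[in RHS]opprB l1normN.
    apply: (@le_trans _ _ (2 * M * (K * (K * (l1norm
        (spectral_sum mu' Q' - spectral_sum mu Q) / delta))))).
      by rewrite !ler_pM ?cmod_ge0 ?mulr_ge0 ?l1norm_ge0.
    rewrite -bE (_ : _ * _ = K ^+ 2 * (2 * M / delta * b)); last by ring.
    by rewrite ler_wpM2l ?exprn_ge0 // /B mulrDr; lra.
  apply: (@le_trans _ _ (e * (K * K))).
    by rewrite !ler_pM ?cmod_ge0 ?mulr_ge0 ?l1norm_ge0 ?phie.
  by rewrite mulrC -expr2 ler_wpM2l ?exprn_ge0 // /B mulrDr; lra.
rewrite /bimodule_sum -sumrB; under eq_bigr do rewrite -sumrB.
under eq_bigr do under eq_bigr do rewrite -sumrB.
under eq_bigr do under eq_bigr do under eq_bigr do rewrite -sumrB.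
under eq_bigr do under eq_bigr do under eq_bigr do under eq_bigr do
  rewrite -scalerBl.
have count (c : R) :
    n%:R ^+ 4 * c = \sum_(i < n) \sum_(j < n) \sum_(k < n) \sum_(l < n) c.
  by rewrite !sumr_const card_ord -!mulrnA -[RHS]mulr_natl !natrM
     !exprS expr0 mulr1 !mulrA.
have -> : n%:R ^+ 12 * B * l1norm X = n%:R ^+ 4 * (K ^+ 2 * B * l1norm X).
  by rewrite [RHS]mulrA (mulrA _ (K ^+ 2)) -exprM -exprD.
rewrite count.
apply: le_trans (l1norm_sum _ _ _) _; apply: ler_sum => i _.
apply: le_trans (l1norm_sum _ _ _) _; apply: ler_sum => j _.
apply: le_trans (l1norm_sum _ _ _) _; apply: ler_sum => k _.
apply: le_trans (l1norm_sum _ _ _) _; apply: ler_sum => l _.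
rewrite l1normZ; apply: le_trans (ler_wpM2r (l1norm_ge0 X) (term i j k l)).
rewrite -mulrA ler_wpM2l ?cmod_ge0 // mulrAC.
rewrite (le_trans (l1normM _ _)) // ler_wpM2r ?l1norm_ge0 //.
exact: l1normM.
Qed.

End MatrixTransform.

(** * Tensors as matrices *)

Lemma finType_enumeration (T : finType) n :
  #|T| = n -> exists e : 'I_n -> T, bijective e.
Proof.
move=> Tn; exists (fun i => enum_val (cast_ord (esym Tn) i)).
exists (fun x => cast_ord Tn (enum_rank x)) => x.
  by rewrite enum_valK cast_ordKV.
by rewrite cast_ordK enum_rankK.
Qed.

Lemma midx_enumeration N (I : 'I_N -> nat) :
  exists e : 'I_(\prod_k I k) -> midx I, bijective e.
Proof.
apply: finType_enumeration; rewrite card_dep_ffun foldrE big_map -big_enum.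
by apply: eq_bigr => k _; rewrite card_ord.
Qed.

Lemma midx_shape1_enumeration : exists e : 'I_1 -> midx shape1, bijective e.
Proof. by have := midx_enumeration shape1; rewrite big_ord1. Qed.

Section TensorMatrix.
Context {R : realType}.
Local Notation C := R[i].

Section Matricization.
Context {N M m n : nat} {I : 'I_N -> nat} {J : 'I_M -> nat}.
Variables (e : 'I_m -> midx I) (f : 'I_n -> midx J).

(** The matrix of a tensor with respect to enumerations of the two sets of
multi-indices. *)
Definition tmx (X : tensor R I J) : 'M[C]_(m, n) := \matrix_(i, j) X (e i, f j).

Lemma tmxB X Y : tmx (X - Y) = tmx X - tmx Y.
Proof. by apply/matrixP => i j; rewrite !mxE !ffunE. Qed.

Lemma tmxZ a X : tmx (a *: X) = a *: tmx X.
Proof. by apply/matrixP => i j; rewrite !mxE !ffunE. Qed.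

Lemma tmx_sum (K : Type) (r : seq K) (P : pred K) (F : K -> tensor R I J) :
  tmx (\sum_(k <- r | P k) F k) = \sum_(k <- r | P k) tmx (F k).
Proof.
apply/matrixP => i j; rewrite mxE sum_ffunE summxE.
by apply: eq_bigr => k _; rewrite mxE.
Qed.

End Matricization.

Lemma tmx_einstein {N M L m n p} {I : 'I_N -> nat} {J : 'I_M -> nat}
    {K : 'I_L -> nat} (e : 'I_m -> midx I) (f : 'I_n -> midx J)
    (g : 'I_p -> midx K) (X : tensor R I J) (Y : tensor R J K) :
  bijective f -> tmx e g (einstein X Y) = tmx e f X *m tmx f g Y.
Proof.
move=> fbij; apply/matrixP => i j; rewrite !mxE ffunE /=.
rewrite (reindex f) /=; last exact: onW_bij.
by apply: eq_bigr => k _; rewrite !mxE.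
Qed.

Lemma tmx_adjoint {N M m n} {I : 'I_N -> nat} {J : 'I_M -> nat}
    (e : 'I_m -> midx I) (f : 'I_n -> midx J) (X : tensor R I J) :
  tmx f e (adjoint X) = map_mx Num.conj (tmx e f X)^T.
Proof. by apply/matrixP => i j; rewrite !mxE ffunE. Qed.

Lemma tmx_id {N n} {I : 'I_N -> nat} (e : 'I_n -> midx I) :
  injective e -> tmx e e (idtensor I) = 1%:M.
Proof. by move=> einj; apply/matrixP => i j; rewrite !mxE ffunE /= inj_eq. Qed.

Lemma tmx_inj {N M m n} {I : 'I_N -> nat} {J : 'I_M -> nat}
    (e : 'I_m -> midx I) (f : 'I_n -> midx J) :
  bijective e -> bijective f -> injective (tmx e f : tensor R I J -> _).
Proof.
move=> [e' e'K eK] [f' f'K fK] X Y XY; apply/ffunP => -[i j].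
by move/matrixP: XY => /(_ (e' i) (f' j)); rewrite !mxE eK fK.
Qed.

Lemma tmx_surj {N M m n} {I : 'I_N -> nat} {J : 'I_M -> nat}
    (e : 'I_m -> midx I) (f : 'I_n -> midx J) (A : 'M[C]_(m, n)) :
  bijective e -> bijective f -> exists X : tensor R I J, tmx e f X = A.
Proof.
move=> [e' e'K eK] [f' f'K fK].
exists [ffun p => A (e' p.1) (f' p.2)].
by apply/matrixP => i j; rewrite mxE ffunE /= e'K f'K.
Qed.

End TensorMatrix.

(** * Comparison of the spectral norm with the entrywise norm *)

Section HilbertSchmidt.
Context {R : realType}.
Local Notation C := R[i].

(** The square of the Hilbert-Schmidt norm. *)
Definition hsnorm2 m n (A : 'M[C]_(m, n)) : R :=
  \sum_i \sum_j cmod (A i j) ^+ 2.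

Lemma hsnorm2_ge0 m n (A : 'M[C]_(m, n)) : 0 <= hsnorm2 A.
Proof. by apply: sumr_ge0 => i _; apply: sumr_ge0 => j _; rewrite sqr_ge0. Qed.

Lemma sqr_cmod_le_hsnorm2 m n (A : 'M[C]_(m, n)) i j :
  cmod (A i j) ^+ 2 <= hsnorm2 A.
Proof.
rewrite /hsnorm2 (bigD1 i) //= (bigD1 j) //= -addrA lerDl addr_ge0 //.
  by apply: sumr_ge0 => *; rewrite sqr_ge0.
by apply: sumr_ge0 => ? _; apply: sumr_ge0 => *; rewrite sqr_ge0.
Qed.

Lemma hsnorm2_gt0 m n (A : 'M[C]_(m, n)) : A != 0 -> 0 < hsnorm2 A.
Proof.
move=> A0; rewrite lt_neqAle hsnorm2_ge0 andbT; apply: contra A0 => /eqP A0.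
apply/eqP/matrixP => i j; rewrite mxE; apply/eqP; rewrite -cmod_eq0.
rewrite -sqrf_eq0.
by rewrite eq_le sqr_ge0 andbT A0 sqr_cmod_le_hsnorm2.
Qed.

Lemma mxtrace_gram m n (A : 'M[C]_(m, n)) :
  \tr (map_mx Num.conj A^T *m A) = (hsnorm2 A)%:C.
Proof.
rewrite /mxtrace /hsnorm2 exchange_big rmorph_sum; apply: eq_bigr => j _ /=.
rewrite mxE rmorph_sum; apply: eq_bigr => i _ /=.
by rewrite !mxE rmorphXn /= cmodE normCKC.
Qed.

Lemma adjoint_mul m n p (A : 'M[C]_(m, n)) (B : 'M[C]_(n, p)) :
  map_mx Num.conj (A *m B)^T = map_mx Num.conj B^T *m map_mx Num.conj A^T.
Proof. by rewrite trmx_mul map_mxM. Qed.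

(** The trace is the sum of the eigenvalues, read off from the second coefficient
of the characteristic polynomial. This gives a large eigenvalue of a Gram matrix
without diagonalizing it. *)
Lemma mxtrace_roots n (A : 'M[C]_n) : (0 < n)%N ->
  exists r : seq C, [/\ size r = n, \tr A = \sum_(a <- r) a &
    forall a, a \in r -> eigenvalue A a].
Proof.
move=> n0; have [r rE] := closed_field_poly_normal (char_poly A).
move: rE; rewrite (monicP (char_poly_monic A)) scale1r => rE.
have sr : size r = n.
  have := size_char_poly A; rewrite rE size_prod_XsubC.
  by case.
exists r; split => // [|a ar].
  apply: oppr_inj; rewrite -char_poly_trace // rE -[X in _`_X.-1]sr.
  by rewrite coefPn_prod_XsubC // sr -lt0n.
by rewrite eigenvalue_root_char rE root_prod_XsubC.
Qed.

End HilbertSchmidt.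

Section SpectralNorm.
Context {R : realType} {N n : nat} {I : 'I_N -> nat}.
Variable e : 'I_n -> midx I.
Hypothesis e_bij : bijective e.
Local Notation C := R[i].
Implicit Types X Y : tensor R I I.

Lemma singular_value_mx X s : singular_value X s ->
  0 <= s /\ exists2 v : 'cV[C]_n, v != 0 &
    map_mx Num.conj (tmx e e X)^T *m tmx e e X *m v = (s ^+ 2)%:C *: v.
Proof.
have [e1 e1_bij] := midx_shape1_enumeration.
case=> s0 [V [V0 VE]]; split=> //; exists (tmx e e1 V).
  apply: contra V0 => /eqP V0; apply/eqP; apply: (tmx_inj e_bij e1_bij).
  by rewrite V0; apply/matrixP => i j; rewrite !mxE ffunE.
rewrite -tmx_adjoint -(tmx_einstein e e) // -(tmx_einstein e e1) // VE.
by rewrite tmxZ.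
Qed.

Lemma mx_singular_value X s : 0 <= s ->
  (exists2 v : 'cV[C]_n, v != 0 &
    map_mx Num.conj (tmx e e X)^T *m tmx e e X *m v = (s ^+ 2)%:C *: v) ->
  singular_value X s.
Proof.
have [e1 e1_bij] := midx_shape1_enumeration.
move=> s0 [v v0 vE]; split=> //.
have [V VE] := tmx_surj v e_bij e1_bij; exists V; split.
  apply: contra v0 => /eqP V0; apply/eqP; rewrite -VE V0.
  by apply/matrixP => i j; rewrite !mxE ffunE.
apply: (tmx_inj e_bij e1_bij).
by rewrite (tmx_einstein e e1 _ _ e_bij) (tmx_einstein e e _ _ e_bij)
           tmx_adjoint VE vE tmxZ VE.
Qed.

(** Submultiplicativity on s^2 v = A^H A v bounds s^2 by the square of the
norm of A. *)
Lemma singular_value_le_l1norm X s :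
  singular_value X s -> s <= l1norm (tmx e e X).
Proof.
move=> /singular_value_mx[s0 [v v0 vE]].
rewrite -(@ler_pXn2r _ 2) ?nnegrE ?l1norm_ge0 //.
rewrite -(ler_pM2r (l1norm_gt0 v0)).
have -> : s ^+ 2 * l1norm v = l1norm ((s ^+ 2)%:C *: v).
  by rewrite l1normZ cmodR ger0_norm ?sqr_ge0.
rewrite -vE (le_trans (l1normM _ _)) // ler_wpM2r ?l1norm_ge0 //.
by rewrite (le_trans (l1normM _ _)) // l1norm_adjoint.
Qed.

Lemma spectral_norm_ge0 X : 0 <= spectral_norm X.
Proof.
rewrite /spectral_norm.
have [hs|/sup_out->//] := pselect (has_sup [set s | singular_value X s]).
have [[s sX] _] := hs; apply: (@le_trans _ _ s); first by case: sX.
by apply: sup_upper_bound.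
Qed.

Lemma spectral_norm_le_l1norm X : spectral_norm X <= l1norm (tmx e e X).
Proof.
rewrite /spectral_norm.
have [hs|/sup_out->] := pselect (has_sup [set s | singular_value X s]).
  by apply: ge_sup; [case: hs | move=> s /singular_value_le_l1norm].
exact: l1norm_ge0.
Qed.

Lemma singular_value_le_spectral_norm X s :
  singular_value X s -> s <= spectral_norm X.
Proof.
move=> sX; apply: ub_le_sup => //.
by exists (l1norm (tmx e e X)) => ? /singular_value_le_l1norm.
Qed.

(** An eigenvalue a of A^H A equals the ratio |A v|^2 / |v|^2, so it is the
square of a singular value. The transpose turns the row eigenvectors of
[eigenvalue] into the column eigenvectors of [singular_value]. *)
Lemma eigenvalue_gram_le X a :
  eigenvalue (map_mx Num.conj (tmx e e X)^T *m tmx e e X)^T a ->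
  cmod a <= spectral_norm X ^+ 2.
Proof.
set A := tmx e e X => /eigenvalueP[w wE w0]; pose v := w^T.
have v0 : v != 0 by rewrite trmx_eq0.
have vE : map_mx Num.conj A^T *m A *m v = a *: v.
  by apply: trmx_inj; rewrite trmx_mul trmxK wE linearZ /= trmxK.
have aE : a = (hsnorm2 (A *m v) / hsnorm2 v)%:C.
  have v20 := hsnorm2_gt0 v0.
  have := mxtrace_gram (A *m v).
  rewrite adjoint_mul -mulmxA [X in _ *m X]mulmxA vE -scalemxAr mxtraceZ.
  rewrite mxtrace_gram rmorphM fmorphV /= => <-.
  by rewrite mulfK // (inj_eq (@complexI _)) gt_eqF.
have a0 : 0 <= hsnorm2 (A *m v) / hsnorm2 v.
  by rewrite divr_ge0 ?hsnorm2_ge0.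
rewrite aE cmodR ger0_norm // -[leLHS]sqr_sqrtr //.
rewrite ler_pXn2r ?nnegrE ?sqrtr_ge0 ?spectral_norm_ge0 //.
apply/singular_value_le_spectral_norm/mx_singular_value => //.
by exists v => //; rewrite vE sqr_sqrtr // -aE.
Qed.

(** The trace of A^H A is the sum of the squared moduli of the entries of A and
also the sum of n eigenvalues, each at most the square of the spectral norm.
This is where the supremum defining the spectral norm is bounded below. *)
Lemma l1norm_le_spectral_norm X : (0 < n)%N ->
  l1norm (tmx e e X) <= n%:R ^+ 3 * spectral_norm X.
Proof.
move=> n0; set A := tmx e e X; set s := spectral_norm X.
have s0 : 0 <= s by exact: spectral_norm_ge0.
have hsA : hsnorm2 A <= n%:R * s ^+ 2.
  have [r [sr trE rA]] := mxtrace_roots (map_mx Num.conj A^T *m A)^T n0.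
  have -> : hsnorm2 A = cmod (\sum_(a <- r) a).
    by rewrite -trE mxtrace_tr mxtrace_gram cmodR ger0_norm ?hsnorm2_ge0.
  rewrite (le_trans (cmod_sum _ _ _)) //.
  apply: (@le_trans _ _ (\sum_(a <- r) s ^+ 2)).
    by rewrite !big_seq; apply: ler_sum => a /rA /eigenvalue_gram_le.
  by rewrite big_const_seq count_predT sr iter_addr_0 mulr_natl.
have Aij i j : cmod (A i j) <= n%:R * s.
  rewrite -(@ler_pXn2r _ 2) ?nnegrE ?cmod_ge0 ?mulr_ge0 //.
  rewrite (le_trans (sqr_cmod_le_hsnorm2 _ _ _)) // (le_trans hsA) //.
  rewrite exprMn ler_wpM2r ?sqr_ge0 // expr2 ler_peMl //.
  by rewrite -[1]/(1%:R) ler_nat.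
apply: (@le_trans _ _ (\sum_(i < n) \sum_(j < n) n%:R * s)).
  by apply: ler_sum => i _; apply: ler_sum => j _.
by rewrite !sumr_const card_ord -!mulrnA -[leLHS]mulr_natl natrM mulrA -expr2
  -exprSr.
Qed.

End SpectralNorm.

(** * Linearity of the complex integral *)

Section ComplexIntegral.
Context {R : realType} {d : measure_display} {Sigma : measurableType d}.
Variable mu : {measure set Sigma -> \bar R}.
Local Notation C := R[i].
Implicit Types g h : Sigma -> C.

Definition cintegrable g : Prop :=
  mu.-integrable setT (EFin \o (fun s => complex.Re (g s))) /\
  mu.-integrable setT (EFin \o (fun s => complex.Im (g s))).

Lemma eq_cintegral g h : g =1 h -> cintegral mu g = cintegral mu h.
Proof. by move=> /funext ->. Qed.

Lemma cintegrable0 : cintegrable (fun=> 0).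
Proof. by split; apply: integrable0. Qed.

Lemma cintegral0 : cintegral mu (fun=> 0) = 0.
Proof. by rewrite /cintegral /= !Rintegral_cst //= !mul0r. Qed.

Lemma cintegrableD g h :
  cintegrable g -> cintegrable h -> cintegrable (fun s => g s + h s).
Proof.
move=> [rg ig] [rh ih]; split.
  apply: eq_integrable (integrableD measurableT rg rh) => // s _ /=.
  by rewrite ReD.
apply: eq_integrable (integrableD measurableT ig ih) => // s _ /=.
by rewrite ImD.
Qed.

Lemma cintegralD g h : cintegrable g -> cintegrable h ->
  cintegral mu (fun s => g s + h s) = cintegral mu g + cintegral mu h.
Proof.
move=> [rg ig] [rh ih]; rewrite /cintegral.
under eq_Rintegral do rewrite ReD; rewrite RintegralD //.
by under [X in _ +i* X = _]eq_Rintegral do rewrite ImD; rewrite RintegralD.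
Qed.

Lemma integrableMr_EFin (u : Sigma -> R) (c : R) :
  mu.-integrable setT (EFin \o u) ->
  mu.-integrable setT (EFin \o (fun s => u s * c)).
Proof.
move=> iu; apply: eq_integrable (integrableZr measurableT c iu) => // s _ /=.
Qed.

Lemma cintegrableMr g c : cintegrable g -> cintegrable (fun s => g s * c).
Proof.
move=> [rg ig]; split.
  have := integrableB measurableT (integrableMr_EFin (complex.Re c) rg)
           (integrableMr_EFin (complex.Im c) ig).
  by apply: eq_integrable => // s _ /=; rewrite ReM.
have := integrableD measurableT (integrableMr_EFin (complex.Im c) rg)
         (integrableMr_EFin (complex.Re c) ig).
by apply: eq_integrable => // s _ /=; rewrite ImM.
Qed.

Lemma cintegralMr g c : cintegrable g ->
  cintegral mu (fun s => g s * c) = cintegral mu g * c.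
Proof.
move=> [rg ig]; case: c => a b.
rewrite /cintegral [RHS]/(_ * _) /= /ComplexField.mulc.
under eq_Rintegral do rewrite ReM /=.
under [X in _ +i* X = _]eq_Rintegral do rewrite ImM /=.
rewrite RintegralB ?RintegralD ?RintegralZr //; exact: integrableMr_EFin.
Qed.

Lemma cintegral_lincomb (J : Type) (r : seq J) (F : J -> Sigma -> C)
    (c : J -> C) : (forall j, cintegrable (F j)) ->
  cintegral mu (fun s => \sum_(j <- r) F j s * c j) =
  \sum_(j <- r) cintegral mu (F j) * c j.
Proof.
move=> iF; suff [] : cintegrable (fun s => \sum_(j <- r) F j s * c j) /\
  cintegral mu (fun s => \sum_(j <- r) F j s * c j) =
  \sum_(j <- r) cintegral mu (F j) * c j by [].
elim: r => [|j r [IHi IHe]].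
  rewrite big_nil; under [X in cintegrable X]eq_fun do rewrite big_nil.
  under eq_cintegral do rewrite big_nil.
  by split; [exact: cintegrable0 | exact: cintegral0].
rewrite big_cons; under [X in cintegrable X]eq_fun do rewrite big_cons.
under eq_cintegral do rewrite big_cons.
have iFj := cintegrableMr (c j) (iF j).
by split; [exact: cintegrableD | rewrite cintegralD // IHe cintegralMr].
Qed.

End ComplexIntegral.

(** * Boundedness and uniform continuity of the symbol *)

Section DominatedUniformContinuity.
Context {R : realType} {d : measure_display} {Sigma : measurableType d}.
Variable mu : {measure set Sigma -> \bar R}.

Lemma dominated_integrable_EFin (u G : Sigma -> R) :
  measurable_fun setT u -> mu.-integrable setT (EFin \o G) ->
  (forall s, `|u s| <= G s) -> mu.-integrable setT (EFin \o u).
Proof.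
move=> meas_u iG uG; apply: le_integrable iG => //.
  exact/measurable_EFinP.
by move=> s _ /=; rewrite lee_fin (le_trans (uG s)) // ler_norm.
Qed.

(** If uniform continuity failed, there would be pairs of points p_k, q_k at
distance tending to 0 along which the integrals stay apart, although
h p_k - h q_k tends to 0 pointwise and is dominated by 2 G. Working along a
sequence spares any measurability of a modulus of continuity in s. *)
Lemma dominated_Rintegral_unif_continuous (T : pseudoMetricType R)
    (h : T -> Sigma -> R) (G : Sigma -> R) :
  (forall p, measurable_fun setT (h p)) ->
  mu.-integrable setT (EFin \o G) ->
  (forall p s, `|h p s| <= G s) ->
  (forall s (e : R), 0 < e -> exists2 delta : R, 0 < delta &
     forall p q, ball p delta q -> `|h p s - h q s| < e) ->
  forall e : R, 0 < e -> exists2 delta : R, 0 < delta &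
    forall p q, ball p delta q ->
      `|\int[mu]_s h p s - \int[mu]_s h q s| < e.
Proof.
move=> mh iG hG hcont e e0; apply: contrapT => nodelta.
have bad (k : nat) : exists pq : T * T, ball pq.1 k.+1%:R^-1 pq.2 /\
    e <= `|\int[mu]_s h pq.1 s - \int[mu]_s h pq.2 s|.
  apply: contrapT => nobad; apply: nodelta; exists k.+1%:R^-1 => //.
  move=> p q pq; rewrite ltNge; apply/negP => ep; apply: nobad.
  by exists (p, q).
have [pq pqP] := choice bad.
pose D k s := h (pq k).1 s - h (pq k).2 s.
have ih p : mu.-integrable setT (EFin \o h p).
  exact: dominated_integrable_EFin (mh p) iG (hG p).
have iD2 := integrableZl measurableT 2 iG.
have D0 s : (D k s)%:E @[k --> \oo] --> (0%E : \bar R).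
  apply/cvg_EFin; first exact: nearW.
  apply/cvgrPdist_lt => eps eps0.
  have [delta delta0 hd] := hcont s _ eps0.
  near=> k; rewrite /= sub0r normrN; apply: hd.
  apply: le_ball (proj1 (pqP k)); apply: ltW.
  by near: k; exact: near_infty_natSinv_lt (PosNum delta0).
have [||||_ _] := @dominated_convergence _ _ _ mu setT measurableT
  (fun k s => (D k s)%:E) (cst 0%E) (fun s => (2%:E * (EFin \o G) s)%E)
  _ _ _ iD2.
- by move=> k; apply/measurable_EFinP; apply: measurable_funB.
- exact: measurable_cst.
- by apply: aeW => s _; exact: D0.
- apply: aeW => s k _ /=; rewrite -EFinM lee_fin (le_trans (ler_normB _ _)) //.
  by rewrite mulr_natl mulr2n lerD.
rewrite integral0 => /fine_cvgP[_ /cvgrPdist_lt /(_ e e0)].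
move=> [k _ /(_ k (leqnn k))]; rewrite /= sub0r normrN; apply/negP; rewrite -leNgt.
have [_] := pqP k; rewrite -RintegralB //.
Unshelve. all: by end_near. Qed.

End DominatedUniformContinuity.

Section ClassPsi.
Context {R : realType} {d : measure_display} {Sigma : measurableType d}.
Variable mu : {measure set Sigma -> \bar R}.
Variables (fA fB : Sigma -> R -> R[i]) (psi : R -> R -> R[i]).

(** The real-valued majorant of the integrands; under the hypotheses below the
two sup norms are finite, so that taking [fine] loses nothing. *)
Definition supnorm_prod s : R := fine (supnorm (fA s)) * fine (supnorm (fB s)).

Lemma cmod_le_supnorm (f : R -> R[i]) x :
  (supnorm f < +oo)%E -> cmod (f x) <= fine (supnorm f).
Proof.
move=> foo; have fx : ((cmod (f x))%:E <= supnorm f)%E.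
  by apply: ereal_sup_ubound; exists x.
rewrite -lee_fin fineK // ge0_fin_numE //.
by apply: le_trans fx; rewrite lee_fin cmod_ge0.
Qed.

Lemma supnorm_fin_num (f : R -> R[i]) :
  (supnorm f < +oo)%E -> supnorm f \is a fin_num.
Proof.
move=> foo; rewrite ge0_fin_numE //.
apply: (@le_trans _ _ (cmod (f 0))%:E); first by rewrite lee_fin cmod_ge0.
by apply: ereal_sup_ubound; exists 0.
Qed.

Local Notation G := supnorm_prod.

Section Representation.
Hypothesis rep : Psi_representation mu fA fB psi.

Lemma Psi_integrand_le s x y : cmod (fA s x * fB s y) <= G s.
Proof.
have [/(_ s)[fAs fBs] _ _ _] := rep.
by rewrite cmodM ler_pM ?cmod_ge0 ?cmod_le_supnorm.
Qed.

Lemma supnorm_prod_integrable : mu.-integrable setT (EFin \o G).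
Proof.
have [fin _ iG _] := rep; apply: eq_integrable iG => // s _ /=.
by have [fAs fBs] := fin s; rewrite EFinM !fineK // supnorm_fin_num.
Qed.

Lemma Psi_integrand_cintegrable x y :
  cintegrable mu (fun s => fA s x * fB s y).
Proof.
have [_ /(_ x y)[mRe mIm] _ _] := rep.
split; apply: dominated_integrable_EFin supnorm_prod_integrable _ => // s.
  exact: le_trans (normRe_le_cmod _) (Psi_integrand_le s x y).
exact: le_trans (normIm_le_cmod _) (Psi_integrand_le s x y).
Qed.

Lemma Psi_bounded : exists M : R, forall x y, cmod (psi x y) <= M.
Proof.
pose M : R := \int[mu]_s G s; exists (M + M) => x y.
have [_ _ _ ->] := rep; have [iRe iIm] := Psi_integrand_cintegrable x y.
have bnd (u : Sigma -> R) : mu.-integrable setT (EFin \o u) ->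
    (forall s, `|u s| <= G s) -> `|\int[mu]_s u s| <= M.
  move=> iu uG; rewrite (le_trans (le_normr_Rintegral measurableT iu)) //.
  apply: le_Rintegral => //; first exact: (integrable_norm iu).
  exact: supnorm_prod_integrable.
rewrite (le_trans (cmod_le_ReIm _)) // lerD //= bnd // => s.
  exact: le_trans (normRe_le_cmod _) (Psi_integrand_le s x y).
exact: le_trans (normIm_le_cmod _) (Psi_integrand_le s x y).
Qed.

End Representation.

Lemma bounded_mul_unif_continuous (f g : R -> R[i]) (a b : R) :
  (forall x, cmod (f x) <= a) -> (forall x, cmod (g x) <= b) ->
  (forall e : R, 0 < e -> exists2 delta : R, 0 < delta & forall x y,
     `|x - y| < delta -> cmod (f x - f y) < e /\ cmod (g x - g y) < e) ->
  forall e : R, 0 < e -> exists2 delta : R, 0 < delta & forall x y x' y',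
    `|x - x'| < delta -> `|y - y'| < delta ->
    cmod (f x * g y - f x' * g y') < e.
Proof.
move=> fa gb fg e e0.
have a0 : 0 <= a by exact: le_trans (cmod_ge0 _) (fa 0).
have b0 : 0 <= b by exact: le_trans (cmod_ge0 _) (gb 0).
have c0 : 0 < a + b + 1 by rewrite ltr_wpDl ?addr_ge0.
have [delta delta0 h] := fg _ (divr_gt0 e0 c0).
exists delta => // x y x' y' /h[fx _] /h[_ gy].
have -> : f x * g y - f x' * g y' =
    (f x - f x') * g y + f x' * (g y - g y') by ring.
rewrite (le_lt_trans (cmodD _ _)) // !cmodM.
apply: (@le_lt_trans _ _ (e / (a + b + 1) * b + a * (e / (a + b + 1)))).
  by rewrite lerD // ler_pM ?cmod_ge0 // ltW.
rewrite -[ltRHS](divfK (lt0r_neq0 c0)) -subr_gt0.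
rewrite (_ : _ - _ = e / (a + b + 1)); last by ring.
exact: divr_gt0.
Qed.

(** Every s lies in some S_i, so the two functions at s are bounded and uniformly
continuous, and hence so is their product on the plane. Dominated convergence
carries this pointwise information over to the integral. *)
Lemma PsiU_unif_continuous (rep : PsiU_representation mu fA fB psi) (e : R) :
  0 < e -> exists2 delta : R, 0 < delta & forall x y x' y',
    `|x - x'| < delta -> `|y - y'| < delta ->
    cmod (psi x y - psi x' y') <= e.
Proof.
move=> e0; have [repPsi [S [_ _ ST Scont]]] := rep.
have [fin mfg _ psiE] := repPsi.
have icont s (eps : R) : 0 < eps -> exists2 delta : R, 0 < delta &
    forall p q : R * R, ball p delta q ->
      cmod (fA s p.1 * fB s p.2 - fA s q.1 * fB s q.2) < eps.
  move=> eps0; have [i _ Si] : (\bigcup_i S i) s by rewrite ST.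
  have [fAs fBs] := fin s.
  have [|delta delta0 h] := bounded_mul_unif_continuous
    (fun x => cmod_le_supnorm x fAs) (fun x => cmod_le_supnorm x fBs) _ eps0.
    move=> eps1 /(Scont i)[delta delta0 h]; exists delta => // x y xy.
    exact: h.
  by exists delta => // -[x y] [x' y'] [/= xx' yy']; exact: h.
have part_cont (part : R[i] -> R) :
    (forall z w, part (z - w) = part z - part w) ->
    (forall z, `|part z| <= cmod z) ->
    (forall x y, measurable_fun setT (fun s => part (fA s x * fB s y))) ->
    exists2 delta : R, 0 < delta & forall p q : R * R, ball p delta q ->
      `|\int[mu]_s part (fA s p.1 * fB s p.2) -
        \int[mu]_s part (fA s q.1 * fB s q.2)| < e / 2.
  move=> partB part_le mpart.
  apply: (dominated_Rintegral_unif_continuous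
           (h := fun (p : R * R) s => part (fA s p.1 * fB s p.2))
           _ (supnorm_prod_integrable repPsi)).
  - by move=> p; exact: mpart.
  - by move=> p s; rewrite (le_trans (part_le _)) // Psi_integrand_le.
  - move=> s eps /(icont s)[delta delta0 h]; exists delta => // p q /h.
    by apply: le_lt_trans; rewrite -partB.
  - by rewrite divr_gt0.
have [||x y|dRe dRe0 hRe] := part_cont (@complex.Re R).
- by case=> [? ?] [].
- exact: normRe_le_cmod.
- by have [] := mfg x y.
have [||x y|dIm dIm0 hIm] := part_cont (@complex.Im R).
- by case=> [? ?] [].
- exact: normIm_le_cmod.
- by have [] := mfg x y.
exists (Num.min dRe dIm); first by rewrite lt_min dRe0.
move=> x y x' y'; rewrite !lt_min => /andP[xRe xIm] /andP[yRe yIm].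
rewrite !psiE (le_trans (cmod_le_ReIm _)) // (splitr e) lerD //.
  by apply/ltW/(hRe (x, y) (x', y')).
by apply/ltW/(hIm (x, y) (x', y')).
Qed.

End ClassPsi.

(** * Double tensor integrals as finite sums *)

Section EigenDecomposition.
Context {R : realType} {N n : nat} {I : 'I_N -> nat}.
Variable e : 'I_n -> midx I.
Hypothesis e_bij : bijective e.
Local Notation C := R[i].

(** There are as many orthonormal eigentensors as dimensions, so the matrix V
with columns u_i is square and V^H V = 1 implies V V^H = 1, which says that the
projections add up to the identity. *)
Lemma eigen_decomposition_resolution (lam : 'I_n -> R)
    (P : 'I_n -> tensor R I I) (E : tensor R I I) :
  eigen_decomposition lam P E ->
  resolution (fun i => tmx e e (P i)) /\
  tmx e e E = spectral_sum lam (fun i => tmx e e (P i)).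
Proof.
move=> [[U [Uorth PE]] ->]; split; last first.
  by rewrite tmx_sum; apply: eq_bigr => i _; rewrite tmxZ.
have [e1 e1_bij] := midx_shape1_enumeration.
pose u i : 'cV[C]_n := tmx e e1 (U i).
have uu i j : map_mx Num.conj (u i)^T *m u j = (i == j)%:R *: 1%:M.
  rewrite -tmx_adjoint -tmx_einstein // Uorth tmxZ tmx_id //.
  exact: bij_inj.
have Puu i : tmx e e (P i) = u i *m map_mx Num.conj (u i)^T.
  by rewrite PE (tmx_einstein e e _ _ e1_bij) tmx_adjoint.
split=> [i j||i].
- rewrite !Puu mulmxA -(mulmxA (u i)) uu -scalemxAr mulmx1 -scalemxAl.
  by have [->|_] := eqVneq i j; rewrite ?scale1r // !scale0r.
- pose V : 'M[C]_n := \matrix_(p, i) u i p 0.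
  have VV : map_mx Num.conj V^T *m V = 1%:M.
    apply/matrixP => i j; move/matrixP: (uu i j) => /(_ 0 0).
    rewrite !mxE eqxx mulr1 => <-.
    by apply: eq_bigr => p _; rewrite !mxE.
  rewrite -(mulmx1C VV); apply/matrixP => p q.
  rewrite summxE mxE; apply: eq_bigr => i _.
  by rewrite Puu !mxE big_ord1 !mxE.
- have u1 p : cmod (u i p 0) <= 1.
    rewrite -(@ler_pXn2r _ 2) ?nnegrE ?cmod_ge0 // expr1n.
    rewrite (le_trans (sqr_cmod_le_hsnorm2 _ _ _)) //.
    rewrite -[leLHS]ger0_norm ?hsnorm2_ge0 // -cmodR -mxtrace_gram uu eqxx.
    by rewrite scale1r mxtrace1 -[1%:R]/((1 : R)%:C) cmodR normr1.
  have ln : l1norm (u i) <= n%:R.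
    rewrite -[leRHS]mul1r mulr_natr -{2}(card_ord n) -sumr_const.
    by apply: ler_sum => p _; rewrite big_ord1.
  rewrite Puu (le_trans (l1normM _ _)) // l1norm_adjoint expr2.
  by rewrite ler_pM ?l1norm_ge0.
Qed.

(** Each entry of the integrand is a finite linear combination of the functions
f_(A,s)(lam_i) f_(B,s)(mu_j) of s, whose integrals are the values of psi. *)
Lemma tmx_double_tensor_integral {d : measure_display}
    {Sigma : measurableType d}
    (mu : {measure set Sigma -> \bar R}) (fA fB : Sigma -> R -> C)
    (psi : R -> R -> C) (lamA lamB : 'I_n -> R)
    (PA PB : 'I_n -> tensor R I I) (X : tensor R I I) :
  Psi_representation mu fA fB psi ->
  tmx e e (double_tensor_integral mu fA fB lamA lamB PA PB X) =
  bimodule_sum psi lamA lamB (fun i => tmx e e (PA i)) (fun j => tmx e e (PB j))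
    (tmx e e X).
Proof.
move=> rep; have [_ _ _ psiE] := rep.
apply/matrixP => p q; rewrite mxE ffunE.
pose c (ij : 'I_n * 'I_n) : C :=
  (tmx e e (PA ij.1) *m tmx e e X *m tmx e e (PB ij.2)) p q.
have -> : cintegral mu (fun s =>
    einstein (einstein (\sum_i fA s (lamA i) *: PA i) X)
             (\sum_j fB s (lamB j) *: PB j) (e p, e q)) =
  cintegral mu (fun s => \sum_(ij : 'I_n * 'I_n)
     fA s (lamA ij.1) * fB s (lamB ij.2) * c ij).
  apply: eq_cintegral => s.
  transitivity (tmx e e (einstein (einstein (\sum_i fA s (lamA i) *: PA i) X)
             (\sum_j fB s (lamB j) *: PB j)) p q); first by rewrite mxE.
  rewrite !(tmx_einstein e e _ _ e_bij) !tmx_sum mulmx_suml mulmx_suml summxE.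
  rewrite -(pair_big predT predT (fun i j =>
    fA s (lamA i) * fB s (lamB j) * c (i, j))) /=.
  apply: eq_bigr => i _; rewrite mulmx_sumr summxE; apply: eq_bigr => j _.
  by rewrite !tmxZ -!scalemxAl -scalemxAr scalerA mxE.
rewrite cintegral_lincomb; last first.
  by move=> ij; exact: Psi_integrand_cintegrable rep _ _.
rewrite /bimodule_sum summxE -(pair_big predT predT (fun i j =>
  cintegral mu (fun s => fA s (lamA i) * fB s (lamB j)) * c (i, j))) /=.
apply: eq_bigr => i _; rewrite summxE; apply: eq_bigr => j _.
by rewrite -psiE [RHS]mxE.
Qed.

End EigenDecomposition.

(** * The operator norm and expectations *)

Section OperatorNorm.
Context {R : realType} {N n : nat} {I : 'I_N -> nat}.
Variable e : 'I_n -> midx I.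
Hypothesis e_bij : bijective e.
Implicit Types T : tensor R I I -> tensor R I I.

Lemma operator_norm_ge0 T : 0 <= operator_norm T.
Proof.
rewrite /operator_norm; set S := (X in sup X).
have [hs|/sup_out->//] := pselect (has_sup S).
have [[y Sy] _] := hs; have [X _ yE] := Sy.
apply: (@le_trans _ _ y); last exact: sup_upper_bound.
by rewrite -yE; exact: spectral_norm_ge0.
Qed.

(** The factor n^3 is the price of bounding the entrywise norm of X by its
spectral norm. *)
Lemma operator_norm_le_l1norm T c : (0 < n)%N -> 0 <= c ->
  (forall X, l1norm (tmx e e (T X)) <= c * l1norm (tmx e e X)) ->
  operator_norm T <= c * n%:R ^+ 3.
Proof.
move=> n0 c0 Tc; rewrite /operator_norm; set S := (X in sup X).
have [[S0 _]|/sup_out->] := pselect (has_sup S); last first.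
  by rewrite mulr_ge0 // exprn_ge0.
apply: ge_sup => // _ [X X1 <-].
rewrite (le_trans (spectral_norm_le_l1norm e_bij _)) // (le_trans (Tc X)) //.
rewrite ler_wpM2l // (le_trans (l1norm_le_spectral_norm e_bij X n0)) //.
by rewrite ler_piMr // exprn_ge0.
Qed.

End OperatorNorm.

Section Expectation.
Context {R : realType} {d : measure_display} {Omega : measurableType d}.

(** The integral of a nonnegative function is a supremum over the simple
functions below it, a set that grows with the function. *)
Lemma le_ge0_integral (mu : {measure set Omega -> \bar R})
    (f g : Omega -> \bar R) :
  (forall x, 0 <= f x)%E -> (forall x, f x <= g x)%E ->
  (\int[mu]_x f x <= \int[mu]_x g x)%E.
Proof.
move=> f0 fg; rewrite !ge0_integralTE => [||//].
  apply: ereal_sup_le => _ [h hf <-]; exists h => // x.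
  exact: le_trans (hf x) (fg x).
by move=> x; exact: le_trans (f0 x) (fg x).
Qed.

Lemma le_ge0_expectation (P : probability Omega R) (X Y : Omega -> R) :
  (forall w, 0 <= X w) -> (forall w, X w <= Y w) -> ('E_P[X] <= 'E_P[Y])%E.
Proof.
move=> X0 XY; rewrite unlock; apply: le_ge0_integral => w.
  by rewrite lee_fin.
by rewrite lee_fin.
Qed.

Context {N : nat} {I : 'I_N -> nat}.
Implicit Types X Y : Omega -> tensor R I I.

Lemma random_tensor_Re X p :
  random_tensor X -> measurable_fun setT (fun w => complex.Re (X w p)).
Proof.
move=> mX _ B mB; rewrite setTI.
apply: (mX [set Z : tensor R I I | B (complex.Re (Z p))]).
by apply: sub_gen_smallest; exists p, B; split=> //; left.
Qed.

Lemma random_tensor_Im X p :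
  random_tensor X -> measurable_fun setT (fun w => complex.Im (X w p)).
Proof.
move=> mX _ B mB; rewrite setTI.
apply: (mX [set Z : tensor R I I | B (complex.Im (Z p))]).
by apply: sub_gen_smallest; exists p, B; split=> //; right.
Qed.

(** Unlike the spectral norm, the entrywise norm is an explicit expression in
the real and imaginary parts of the entries. *)
Lemma measurable_l1norm_sub {n} (e : 'I_n -> midx I) X Y :
  random_tensor X -> random_tensor Y ->
  measurable_fun setT (fun w => l1norm (tmx e e (X w - Y w))).
Proof.
move=> mX mY; apply: measurable_sum => i; apply: measurable_sum => j.
have -> : (fun w => cmod (tmx e e (X w - Y w) i j)) = Num.sqrt \o
    (fun w => (complex.Re (X w (e i, e j)) - complex.Re (Y w (e i, e j))) ^+ 2 +
              (complex.Im (X w (e i, e j)) - complex.Im (Y w (e i, e j))) ^+ 2).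
  apply/funext => w; rewrite /= mxE !ffunE /cmod normc_def /=.
  by case: (X w _) (Y w _) => [? ?] [].
apply: measurableT_comp.
  by apply: continuous_measurable_fun; exact: sqrt_continuous.
by apply: measurable_funD; apply: measurable_funX; apply: measurable_funB;
  (exact: random_tensor_Re || exact: random_tensor_Im).
Qed.

(** The constant is moved to the measurable side before comparing, where the
integral is known to be homogeneous. *)
Lemma expectation_l1norm_sub_le {n} (e : 'I_n -> midx I)
    (P : probability Omega R) X Y :
  bijective e -> (0 < n)%N -> random_tensor X -> random_tensor Y ->
  ('E_P[(fun w => l1norm (tmx e e (X w - Y w)))%R] <=
   (n%:R ^+ 3)%:E * 'E_P[(fun w => spectral_norm (X w - Y w))%R])%E.
Proof.
move=> e_bij n0 mX mY; pose c : R := n%:R ^+ 3.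
have c0 : 0 < c by rewrite exprn_gt0 // ltr0n.
rewrite -lee_pdivrMl // -/c.
have -> : ((c^-1)%:E * 'E_P[(fun w => l1norm (tmx e e (X w - Y w)))%R] =
           'E_P[fun w => (c^-1 * l1norm (tmx e e (X w - Y w)))%R])%E.
  rewrite unlock -ge0_integralZl_EFin ?invr_ge0 ?(ltW c0) //.
  - by move=> w _; rewrite lee_fin l1norm_ge0.
  - by apply/measurable_EFinP; exact: measurable_l1norm_sub.
apply: le_ge0_expectation => w.
  by rewrite mulr_ge0 ?invr_ge0 ?(ltW c0) ?l1norm_ge0.
by rewrite ler_pdivrMl //; exact: l1norm_le_spectral_norm.
Qed.

End Expectation.

(** * Convergence of the expectations *)

(** The constant c may blow up as e tends to 0, since g is made small after e is
chosen. *)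
Lemma cvge0_affine_bound {R : realType} {T : Type} (F : set_system T)
    {FF : Filter F} (f g : T -> \bar R) :
  (forall t, 0 <= f t)%E -> (forall t, 0 <= g t)%E ->
  (forall e : R, 0 < e -> exists2 c : R, 0 <= c &
     forall t, (f t <= e%:E + c%:E * g t)%E) ->
  g t @[t --> F] --> 0%E -> f t @[t --> F] --> 0%E.
Proof.
move=> f0 g0 fg /fine_cvgP[gfin /cvgrPdist_lt gcvg].
have small (e : R) : 0 < e -> \forall t \near F, (f t <= (e + e)%:E)%E.
  move=> e0; have [c c0 fc] := fg e e0.
  have c1 : 0 < c + 1 by rewrite ltr_wpDl.
  near=> t; rewrite (le_trans (fc t)) // EFinD leeD2l //.
  have gt : g t \is a fin_num by near: t.
  have : `|0 - fine (g t)| < e / (c + 1).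
    by near: t; apply: gcvg; rewrite divr_gt0.
  rewrite sub0r normrN ger0_norm ?fine_ge0 // => gt_lt.
  rewrite -(fineK gt) -EFinM lee_fin.
  rewrite (@le_trans _ _ ((c + 1) * (e / (c + 1)))) //; last first.
    by rewrite mulrC divfK // gt_eqF.
  by rewrite ler_pM ?fine_ge0 ?lerDl // ltW.
apply/fine_cvgP; split.
  near=> t; rewrite ge0_fin_numE // (@le_lt_trans _ _ (1 + 1)%:E) ?ltry //.
  by near: t; exact: small.
apply/cvgrPdist_le => e e0; near=> t.
rewrite sub0r normrN ger0_norm ?fine_ge0 //.
have ft : (f t <= (e / 2 + e / 2)%:E)%E by near: t; apply: small;
  rewrite divr_gt0.
rewrite -splitr in ft; rewrite -lee_fin fineK // ge0_fin_numE //.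
by rewrite (le_lt_trans ft) ?ltry.
Unshelve. all: by end_near. Qed.

Lemma expectation_affine {R : realType} {d : measure_display}
    {Omega : measurableType d} (P : probability Omega R) (X Y : Omega -> R)
    (a b : R) :
  measurable_fun setT X -> measurable_fun setT Y ->
  (forall w, 0 <= X w) -> (forall w, 0 <= Y w) -> 0 <= a -> 0 <= b ->
  ('E_P[(fun w => a + b * (X w + Y w))%R] =
   a%:E + b%:E * ('E_P[X] + 'E_P[Y]))%E.
Proof.
move=> mX mY X0 Y0 a0 b0; rewrite unlock.
under eq_integral do rewrite EFinD EFinM EFinD.
have mXE : measurable_fun setT (EFin \o X) by exact/measurable_EFinP.
have mYE : measurable_fun setT (EFin \o Y) by exact/measurable_EFinP.
rewrite ge0_integralD //=.
- rewrite integral_cst //= probability_setT mule1.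
  rewrite ge0_integralZl_EFin //=.
  + by rewrite ge0_integralD // => w _; rewrite lee_fin.
  + by move=> w _; rewrite adde_ge0 ?lee_fin.
  + exact: emeasurable_funD.
- by move=> w _; rewrite -EFinD -EFinM lee_fin mulr_ge0 // addr_ge0.
- by apply: measurable_funeM; exact: emeasurable_funD.
Qed.

(** The deterministic core: a bound on the operator norm that is affine in the
perturbation of the two tensors, with arbitrarily small constant term. The
exponent 15 is 12 from [bimodule_sum_perturb] plus 3 from
[operator_norm_le_l1norm]. *)
Lemma double_tensor_integral_perturb (R : realType) (N n : nat)
    (I : 'I_N -> nat) (e : 'I_n -> midx I) (d : measure_display)
    (Sigma : measurableType d) (mu : {measure set Sigma -> \bar R})
    (fA fB : Sigma -> R -> R[i]) (psi : R -> R -> R[i]) (M eps delta : R)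
    (lamA lamA' lamB lamB' : 'I_n -> R) (PA PA' PB PB' : 'I_n -> tensor R I I)
    (EA EA' EB EB' : tensor R I I) :
  bijective e -> (0 < n)%N -> Psi_representation mu fA fB psi ->
  0 <= eps -> 0 < delta ->
  (forall x y, cmod (psi x y) <= M) ->
  (forall x y x' y', `|x - x'| < delta -> `|y - y'| < delta ->
     cmod (psi x y - psi x' y') <= eps) ->
  eigen_decomposition lamA PA EA -> eigen_decomposition lamA' PA' EA' ->
  eigen_decomposition lamB PB EB -> eigen_decomposition lamB' PB' EB' ->
  operator_norm (double_tensor_integral mu fA fB lamA lamB PA PB \-
                 double_tensor_integral mu fA fB lamA' lamB' PA' PB') <=
  n%:R ^+ 15 * (eps + 2 * M / delta *
    (l1norm (tmx e e (EA - EA')) + l1norm (tmx e e (EB - EB')))).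
Proof.
move=> e_bij n0 rep eps0 delta0 psiM psic.
move=> /(eigen_decomposition_resolution e_bij)[rA EAE].
move=> /(eigen_decomposition_resolution e_bij)[rA' EAE'].
move=> /(eigen_decomposition_resolution e_bij)[rB EBE].
move=> /(eigen_decomposition_resolution e_bij)[rB' EBE'].
have M0 : 0 <= M by exact: le_trans (cmod_ge0 _) (psiM 0 0).
rewrite (exprD _ 12 3) mulrAC.
apply: (operator_norm_le_l1norm e_bij n0).
  rewrite mulr_ge0 ?exprn_ge0 // addr_ge0 // mulr_ge0 ?addr_ge0 ?l1norm_ge0 //.
  by rewrite divr_ge0 ?mulr_ge0 // ltW.
move=> X; rewrite !tmxB EAE EAE' EBE EBE'.
rewrite !(tmx_double_tensor_integral _ _ _ _ _ _ rep) //.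
exact: bimodule_sum_perturb.
Qed.

Theorem lemma6 (R : realType)
  (N : nat) (I : 'I_N -> nat)
  (N_gt0 : (0 < N)%N) (I_gt0 : forall k, (0 < I k)%N)
  (dS : measure_display) (Sigma : measurableType dS)
  (mu : {measure set Sigma -> \bar R})
  (fA fB : Sigma -> R -> R[i]) (psi : R -> R -> R[i])
  (psiU : PsiU_representation mu fA fB psi)
  (fA_bounded : forall s, bounded_derivatives2 (fA s))
  (fB_bounded : forall s, bounded_derivatives2 (fB s))
  (dO : measure_display) (Omega : measurableType dO)
  (Pr : probability Omega R)
  (lamA lamB : 'I_(\prod_k I k) -> {RV Pr >-> R})
  (PA PB : R -> 'I_(\prod_k I k) -> Omega -> tensor R I I)
  (EA EB : R -> Omega -> tensor R I I)
  (PA_random : forall t i, random_tensor (PA t i))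
  (PB_random : forall t i, random_tensor (PB t i))
  (EA_random : forall t, random_tensor (EA t))
  (EB_random : forall t, random_tensor (EB t))
  (EA_hermitian : forall t w, hermitian_tensor (EA t w))
  (EB_hermitian : forall t w, hermitian_tensor (EB t w))
  (EA_EB_independent : forall t, independent_tensors Pr (EA t) (EB t))
  (EA_decomposition : forall t w,
     eigen_decomposition (fun i => lamA i w) (fun i => PA t i w) (EA t w))
  (EB_decomposition : forall t w,
     eigen_decomposition (fun i => lamB i w) (fun i => PB t i w) (EB t w))
  (EA_cvg : 'E_Pr[(fun w => spectral_norm (EA t w - EA 0 w))%R]%E
              @[t --> (0 : R)^'] --> 0%E)
  (EB_cvg : 'E_Pr[(fun w => spectral_norm (EB t w - EB 0 w))%R]%E
              @[t --> (0 : R)^'] --> 0%E) :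
  let T (t : R) (w : Omega) : tensor R I I -> tensor R I I :=
    double_tensor_integral mu fA fB (fun i => lamA i w) (fun j => lamB j w)
      (fun i => PA t i w) (fun j => PB t j w) in
  'E_Pr[(fun w => operator_norm (T t w \- T 0 w))%R]%E @[t --> (0 : R)^'] --> 0%E.
Proof.
move=> T; set n := (\prod_k I k)%N.
have n0 : (0 < n)%N by rewrite /n; apply: prodn_gt0.
have [e e_bij] := midx_enumeration I.
have [rep _] := psiU; have [M psiM] := Psi_bounded rep.
have M0 : 0 <= M by exact: le_trans (cmod_ge0 _) (psiM 0 0).
pose sA (t : R) := 'E_Pr[(fun w => spectral_norm (EA t w - EA 0 w))%R]%E.
pose sB (t : R) := 'E_Pr[(fun w => spectral_norm (EB t w - EB 0 w))%R]%E.
apply: (@cvge0_affine_bound _ _ _ _ _ (fun t => sA t + sB t)%E).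
- by move=> t; apply: expectation_ge0 => w; exact: operator_norm_ge0.
- by move=> t; rewrite adde_ge0 // expectation_ge0 // => w;
    exact: spectral_norm_ge0.
- move=> eps eps0; pose K : R := n%:R ^+ 15.
  have K0 : 0 < K by rewrite exprn_gt0 // ltr0n.
  (* eps / K makes up for the dimensional factor in front of the bound. *)
  have [delta delta0 psic] := PsiU_unif_continuous psiU (divr_gt0 eps0 K0).
  pose c : R := K * (2 * M / delta).
  have c0 : 0 <= c by rewrite mulr_ge0 ?divr_ge0 ?mulr_ge0 // ltW.
  exists (c * n%:R ^+ 3); first by rewrite mulr_ge0 // exprn_ge0.
  move=> t.
  pose a w := l1norm (tmx e e (EA t w - EA 0 w)).
  pose b w := l1norm (tmx e e (EB t w - EB 0 w)).
  (* The pointwise bound is kept in terms of the entrywise norms, so that it is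
     measurable and its expectation can be expanded. *)
  apply: (@le_trans _ _ ('E_Pr[(fun w => eps + c * (a w + b w))%R])%E).
    apply: le_ge0_expectation => w; first exact: operator_norm_ge0.
    have := double_tensor_integral_perturb e_bij n0 rep
      (ltW (divr_gt0 eps0 K0)) delta0 psiM psic
      (EA_decomposition t w) (EA_decomposition 0 w)
      (EB_decomposition t w) (EB_decomposition 0 w).
    by rewrite mulrDr mulrA -/K mulrCA divff ?gt_eqF // mulr1.
  rewrite expectation_affine ?(ltW eps0) //; last 4 first.
  + exact: measurable_l1norm_sub.
  + exact: measurable_l1norm_sub.
  + by move=> w; exact: l1norm_ge0.
  + by move=> w; exact: l1norm_ge0.
  rewrite leeD2l // (EFinM c) -muleA lee_wpmul2l ?lee_fin //.
  rewrite ge0_muleDr ?leeD ?expectation_l1norm_sub_le //;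
    by apply: expectation_ge0 => w; exact: spectral_norm_ge0.
- rewrite -[X in _ --> X]adde0; apply: cvgeD => //.
Qed.
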